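(* Let $k>1$ be an integer and let $\nu$ be a probability distribution on $\mathbb{R}^k$ which is not gaussian, but such that whenever $(X_1,\dots,X_k)$ has distribution $\nu$, for every $i\in\{1,\dots,k\}$ the $k-1$ random variables $X_1,\dots,X_{i-1},X_{i+1},\dots,X_k$ (the $i$-th one omitted) are i.i.d. $N(0,1)$. Let $\{(X_{n1},X_{n2},\dots,X_{nk}) : n\in\mathbb{Z}\}$ be a bilateral sequence of i.i.d. $\mathbb{R}^k$-valued random variables with common distribution $\nu$, and define $$Y_n = X_{n\,k} + X_{n+1\,\,k-1} + X_{n+2\,\,k-2} + \cdots + X_{n+k-1\,\,1},\qquad n\in\mathbb{Z}.$$ Then the process $\{Y_n : n\in\mathbb{Z}\}$ is strictly stationary and $(k-1)$-step independent, i.e. for every integer $m$ the families $\{Y_n : n\le m\}$ and $\{Y_n : n\ge m+k\}$ are independent; moreover, for any distinct integers $n_1<n_2<\dots<n_{k-1}$, the random vector $(Y_{n_1},\dots,Y_{n_{k-1}})$ is gaussian with mean $\mathbf{0}$ and covariance matrix $kI$, where $I$ is the identity matrix of order $k-1$. In particular, $\{Y_n\}$ is ergodic (with respect to the shift).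
   Context: An example of such a $\nu$ is the distribution with density $\psi(\mathbf{x}) = (2\pi)^{-k/2}\{1 + x_1x_2\cdots x_k\, e^{-|\mathbf{x}|^2/2}\}e^{-|\mathbf{x}|^2/2}$ on $\mathbb{R}^k$. In the definition of $Y_n$, the summand $X_{r\,s}$ denotes the $s$-th coordinate of the $r$-th vector of the sequence; the sum of the two indices in each summand equals $n+k$. *)

(* Defs.v *)
From HB Require Import structures.
From mathcomp Require Import all_boot all_order all_algebra.
From mathcomp Require Import all_classical all_reals all_analysis.
Set Implicit Arguments. Unset Strict Implicit. Unset Printing Implicit Defensive.
Import Order.TTheory GRing.Theory Num.Theory.
Local Open Scope classical_set_scope.
Local Open Scope ring_scope.

Section Defs.
Variable R : realType.

Definition gauss_law (m v : R) : set R -> \bar R :=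
  if v == 0 then @dirac _ R m R else normal_prob m (Num.sqrt v).

Definition coord_sigma (I : Type) : set (set (I -> R)) :=
  <<s [set A | exists i (B : set R), measurable B /\ A = (fun f => f i) @^-1` B] >>.

Variables (d : measure_display) (Omega : measurableType d).
Variable P : probability Omega R.

Definition gen_sigma (I : Type) (Z : I -> Omega -> R) (S : set I) : set (set Omega) :=
  <<s [set A | exists i (B : set R), [/\ S i, measurable B & A = Z i @^-1` B]] >>.

Definition indep2 (F G : set (set Omega)) : Prop :=
  forall A B, F A -> G B -> P (A `&` B) = (P A * P B)%E.

Definition mutual_indep (I : eqType) (F : I -> set (set Omega)) : Prop :=
  forall (J : seq I) (A : I -> set Omega), uniq J ->
    (forall i, i \in J -> F i (A i)) ->
    P (\bigcap_(i in [set i | i \in J]) A i) = (\prod_(i <- J) P (A i))%E.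

End Defs.

Section Laws.
Variable R : realType.

Definition gaussian_law (k : nat) (mu : set ('I_k -> R) -> \bar R) : Prop :=
  forall t : 'I_k -> R, exists m v : R, 0 <= v /\
    forall B : set R, measurable B ->
      mu [set x | B (\sum_(i < k) t i * x i)] = gauss_law m v B.

Definition lshift_path (y : int -> R) : int -> R := fun n => y (n + 1).

End Laws.

(* Main.v *)
(** Each Y_n sums k coordinates taken from k consecutive vectors X_n, ...,
    X_(n+k-1), so Y is a shift-equivariant function of the i.i.d. sequence X
    (stationarity), and {Y_i : i <= m}, {Y_i : i >= m + k} depend on disjoint
    blocks of X (independence).  Regroup a linear combination
    t_1 Y_(n_1) + ... + t_(k-1) Y_(n_(k-1)) by the vectors X_m: for fixed m each
    Y_(n_j) uses at most one coordinate of X_m, and different j use different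
    ones, so at least one of the k coordinates of X_m does not occur and the
    others are independent N(0,1).  The combination is thus a sum of
    independent centered normal variables of total variance k (sum_j t_j ^ 2).
    For ergodicity, approximate an invariant event B by an event A depending on
    finitely many Y_i; a far translate of A is independent of A and still
    approximates B, hence P(B) = P(B)^2. *)

Require Import Defs.
From HB Require Import structures.
From mathcomp Require Import all_boot all_order all_algebra.
From mathcomp Require Import all_classical all_reals all_analysis measurable_realfun.
From mathcomp Require Import ring lra zify.
Import Order.TTheory GRing.Theory Num.Theory.
Set Implicit Arguments.
Unset Strict Implicit.
Local Open Scope classical_set_scope.
Local Open Scope ring_scope.

(** * Normal laws *)

Section density.
Local Open Scope ereal_scope.
Context d (T : measurableType d) (R : realType).
Variables (mu nu : {measure set T -> \bar R}) (g : T -> R).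
Hypothesis mg : measurable_fun setT g.
Hypothesis g0 : forall x, (0 <= g x)%R.
Hypothesis nuE : forall A, measurable A -> nu A = \int[mu]_(x in A) (g x)%:E.

Import HBNNSimple.

(** Holds for indicators by [nuE], for simple functions by linearity, and in general by monotone
    convergence along [nnsfun_approx]. *)
Lemma ge0_integral_density (f : T -> \bar R) :
  measurable_fun setT f -> (forall x, 0 <= f x) ->
  \int[nu]_x f x = \int[mu]_x (f x * (g x)%:E).
Proof.
move=> mf f0; pose f_ := nnsfun_approx measurableT mf.
have mfg n : measurable_fun setT (fun x => (f_ n x)%:E * (g x)%:E).
  by apply: emeasurable_funM; exact/measurable_EFinP.
have indicE' E : measurable E ->
    \int[mu]_x ((\1_E x)%:E * (g x)%:E) = \int[nu]_x (\1_E x)%:E.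
  move=> mE; rewrite integral_indic// setIT nuE// [RHS]integral_mkcond.
  apply: eq_integral => x _; rewrite patchE indicE.
  by case: ifP; rewrite ?mul1e ?mul0e.
have sfunE (h : {nnsfun T >-> R}) :
    \int[mu]_x ((h x)%:E * (g x)%:E) = \int[nu]_x (h x)%:E.
  under [RHS]eq_integral do rewrite fimfunE -fsumEFin//.
  rewrite [RHS]ge0_integral_fsum//; last 2 first.
    - by move=> r; exact/measurable_EFinP/measurableT_comp.
    - by move=> n x _; rewrite EFinM nnfun_muleindic_ge0.
  under [LHS]eq_integral.
    move=> x xD; rewrite fimfunE -fsumEFin// muleC ge0_mule_fsumr//; last first.
      by move=> r; rewrite EFinM nnfun_muleindic_ge0.
    over.
  rewrite [LHS]ge0_integral_fsum//; last 2 first.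
    - move=> r; apply/emeasurable_funM; first exact/measurable_EFinP.
      by apply/measurable_EFinP; apply/measurable_funM.
    - move=> n x _; apply: mule_ge0; first by rewrite lee_fin.
      by rewrite EFinM nnfun_muleindic_ge0.
  apply: eq_fsbigr => r _.
  (* The sum runs over all real [r]; a negative value is never taken, so both terms vanish. *)
  have [r0|r0] := ltP r 0%R.
    rewrite preimage_nnfun0//.
    by rewrite !integral0_eq// => x _; rewrite indic0 mulr0 ?mule0.
  rewrite integralZl_indic_nnsfun// -indicE'//.
  rewrite -ge0_integralZl//.
  - by apply: eq_integral => x _; rewrite EFinM muleCA; congr *%E; exact: muleC.
  - by apply: emeasurable_funM; exact/measurable_EFinP.
  - by move=> x _; rewrite mule_ge0// lee_fin.
transitivity (limn (fun n => \int[nu]_x (f_ n x)%:E)).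
  rewrite -monotone_convergence//.
  - by apply: eq_integral => x _; apply/esym/cvg_lim => //; exact: cvg_nnsfun_approx.
  - by move=> n; exact/measurable_EFinP/measurable_funTS.
  - by move=> n x _; rewrite lee_fin.
  - by move=> x _ m n mn; rewrite lee_fin; exact/lefP/nd_nnsfun_approx.
transitivity (limn (fun n => \int[mu]_x ((f_ n x)%:E * (g x)%:E))).
  by apply/congr_lim/funext => n; rewrite sfunE.
rewrite -monotone_convergence//.
- apply: eq_integral => x _; apply/cvg_lim => //.
  by apply: cvgeZr => //; exact: cvg_nnsfun_approx.
- by move=> n x _; rewrite mule_ge0 ?lee_fin.
- move=> x _ m n mn; apply: lee_wpmul2r; rewrite lee_fin//.
  exact/lefP/nd_nnsfun_approx.
Qed.

End density.

Section normal.
Local Open Scope ereal_scope.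
Context {R : realType}.
Local Notation mu := (@lebesgue_measure R).

Let affine (c e : R) : measurableTypeR R -> measurableTypeR R := fun x => (c * x + e)%R.

Let measurable_affine c e : measurable_fun setT (affine c e).
Proof. by apply: measurable_funD => //; exact: measurable_funM. Qed.

(** By uniqueness of Lebesgue measure, it suffices to compare with the scaled pushforward on
    intervals []a, b]]. For [c < 0] the preimage is closed on the left and open on the right, which
    does not change its length. *)
Lemma lebesgue_measure_affine (c e : R) (A : set R) : c != 0%R -> measurable A ->
  mu A = `|c|%R%:E * mu [set x | A (c * x + e)%R].
Proof.
move=> c0 mA.
(* The instance is written out because inference does not find the
   measurability proof of [affine c e]. *)
pose m : {measure set (measurableTypeR R) -> \bar R} := mscale (NngNum (normr_ge0 c))
  (measure_function_pushforward__canonical__measure_function_Measure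
     mu (measurable_affine c e)).
transitivity (m A); last by [].
move: A mA; apply: (@lebesgue_measure_unique R m) => _ [[a b]] _ <-.
change (mu `]a, b]%classic = `|c|%R%:E * mu (affine c e @^-1` `]a, b]%classic)).
have [ab|ab] := leP b a.
  rewrite (_ : affine _ _ @^-1` _ = set0) ?measure0 ?mule0.
    by rewrite lebesgue_measure_itv/= lte_fin ltNge ab.
  by apply/seteqP; split => // x /=; rewrite in_itv/=; lra.
case: (ltgtP c 0%R) c0 => // c0 _.
- rewrite (_ : affine _ _ @^-1` _ = `[((b - e) / c)%R, ((a - e) / c)%R[%classic); last first.
    apply/seteqP; split=> x /=; rewrite !in_itv/= /affine;
      by rewrite ler_ndivrMr// ltr_ndivlMr// => /andP[? ?]; apply/andP; split; lra.
  rewrite !lebesgue_measure_itv/= !lte_fin ab ltr_ndivlMr// mulfVK ?lt_eqF//.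
  rewrite ltrD2r ab ltr0_norm// -!EFinB -EFinM; congr EFin.
  by field; rewrite lt_eqF.
- rewrite (_ : affine _ _ @^-1` _ = `]((a - e) / c)%R, ((b - e) / c)%R]%classic); last first.
    apply/seteqP; split=> x /=; rewrite !in_itv/= /affine;
      by rewrite ltr_pdivrMr// ler_pdivlMr// => /andP[? ?]; apply/andP; split; lra.
  rewrite !lebesgue_measure_itv/= !lte_fin ab ltr_pdivrMr// mulfVK ?gt_eqF//.
  rewrite ltrD2r ab gtr0_norm// -!EFinB -EFinM; congr EFin.
  by field; rewrite gt_eqF.
Qed.

Lemma ge0_integral_affine (c e : R) (A : set R) (f : R -> \bar R) : c != 0%R ->
  measurable A -> measurable_fun setT f -> (forall x, 0 <= f x) ->
  \int[mu]_(x in A) f x =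
  `|c|%R%:E * \int[mu]_(x in [set x | A (c * x + e)%R]) f (c * x + e)%R.
Proof.
move=> c0 mA mf f0.
pose m : {measure set (measurableTypeR R) -> \bar R} := mscale (NngNum (normr_ge0 c))
  (measure_function_pushforward__canonical__measure_function_Measure
     mu (measurable_affine c e)).
have mfA : measurable_fun A f by exact: measurable_funTS.
rewrite (@eq_measure_integral _ (measurableTypeR R) R A m); last first.
  by move=> B mB _; rewrite /m /mscale/= /pushforward; exact: lebesgue_measure_affine.
rewrite ge0_integral_mscale//; congr *%E.
by rewrite ge0_integral_pushforward.
Qed.

(** After the substitution, the Jacobian [|c|] cancels against the peak of the density. The
    deviation is written [Num.sqrt (c ^+ 2)] to match [gauss_law] with variance [c ^+ 2]. *)
Lemma normal_prob_scale (c : R) (B : set R) : c != 0%R -> measurable B ->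
  normal_prob 0 1 [set x | B (c * x)%R] = normal_prob 0 (Num.sqrt (c ^+ 2)) B.
Proof.
move=> c0 mB; rewrite /normal_prob [RHS](@ge0_integral_affine c 0)//; last 2 first.
- by apply/measurable_EFinP; exact: measurable_normal_pdf.
- by move=> x; rewrite lee_fin normal_pdf_ge0.
rewrite -ge0_integralZl//; last 3 first.
- have := @measurable_affine c 0 measurableT B mB.
  by rewrite setTI.
- apply/measurable_EFinP/measurable_funTS.
  apply: (measurableT_comp (measurable_normal_pdf 0 (Num.sqrt (c ^+ 2)))).
  exact: measurable_affine.
- by move=> x _; rewrite lee_fin normal_pdf_ge0.
rewrite (_ : [set x | B (c * x + 0)%R] = [set x | B (c * x)%R]); last first.
  by apply/seteqP; split => x /=; rewrite addr0.
apply: eq_integral => x _; rewrite -EFinM; congr EFin.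
rewrite addr0 sqrtr_sqr !normal_pdfE ?oner_eq0 ?normr_eq0//.
rewrite /normal_peak /normal_fun !subr0 real_normK ?num_real//.
rewrite expr1n mul1r mulrA; congr (_ * expR _)%R; last by field.
rewrite -mulrnAr sqrtrM ?sqr_ge0// sqrtr_sqr invfM mulrA divff ?mul1r//.
by rewrite normr_eq0.
Qed.

(* Completing the square in [x]. *)
Lemma normal_pdf_conv (a b x z : R) : (0 < a)%R -> (0 < b)%R ->
  (normal_pdf 0 (Num.sqrt b) (z - x) * normal_pdf 0 (Num.sqrt a) x =
   normal_pdf 0 (Num.sqrt (a + b)) z *
   normal_pdf (z * a / (a + b)) (Num.sqrt (a * b / (a + b))) x)%R.
Proof.
move=> a0 b0.
have ab0 : (0 < a + b)%R by rewrite addr_gt0.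
have c0 : (0 < a * b / (a + b))%R by rewrite divr_gt0// mulr_gt0.
rewrite !normal_pdfE ?gt_eqF ?sqrtr_gt0//.
rewrite /normal_peak /normal_fun !sqr_sqrtr ?ltW// mulrACA -expRD.
rewrite [RHS]mulrACA -expRD; congr (_ * expR _)%R.
  rewrite -!invfM -!sqrtrM; last 2 first.
  - by rewrite mulrn_wge0// mulr_ge0 ?ltW ?pi_gt0.
  - by rewrite mulrn_wge0// mulr_ge0 ?ltW ?pi_gt0.
  by congr ((Num.sqrt _)^-1)%R; field; rewrite gt_eqF.
by field; rewrite !gt_eqF.
Qed.

(** Computed on densities: Tonelli makes the integral over [x] the inner one, and [normal_pdf_conv]
    leaves in it a normal density, of integral 1. *)
Lemma normal_prob_conv (a b : R) (B : set R) : (0 < a)%R -> (0 < b)%R ->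
  measurable B ->
  \int[normal_prob 0 (Num.sqrt a)]_x normal_prob 0 (Num.sqrt b) [set y | B (x + y)%R]
  = normal_prob 0 (Num.sqrt (a + b)) B.
Proof.
move=> a0 b0 mB.
have mpdf m s : measurable_fun setT (fun x : R => (normal_pdf m s x)%:E).
  by apply/measurable_EFinP; exact: measurable_normal_pdf.
have pdf_ge0 m s (x : R) : 0 <= (normal_pdf m s x)%:E.
  by rewrite lee_fin normal_pdf_ge0.
pose q (p : R * R) := (normal_pdf 0 (Num.sqrt b) (p.2 - p.1) * \1_B p.2)%R.
pose h (p : R * R) := (q p * normal_pdf 0 (Num.sqrt a) p.1)%R.
have mq : measurable_fun setT q.
  apply: measurable_funM; last exact: measurableT_comp.
  apply: (measurableT_comp (measurable_normal_pdf _ _)).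
  by apply: measurable_funB; [exact: measurable_snd|exact: measurable_fst].
have mh : measurable_fun setT (EFin \o h).
  apply/measurable_EFinP/measurable_funM => //.
  exact: (measurableT_comp (measurable_normal_pdf _ _)).
have h0 p : 0 <= (EFin \o h) p.
  by rewrite /= lee_fin !mulr_ge0 ?normal_pdf_ge0.
(* The translation [z = x + y] moves the dependence on [x] from the set to the density, so that
   Tonelli applies. *)
have shiftE (x : R) : normal_prob 0 (Num.sqrt b) [set y | B (x + y)%R] =
    \int[mu]_z (normal_pdf 0 (Num.sqrt b) (z - x) * \1_B z)%:E.
  transitivity (\int[mu]_(z in B) (normal_pdf 0 (Num.sqrt b) (z - x))%:E).
    rewrite [RHS](@ge0_integral_affine 1 x)//; last first.
      apply/measurable_EFinP/(measurableT_comp (measurable_normal_pdf _ _)).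
      exact: measurable_funB.
    rewrite normr1 mul1e /normal_prob.
    rewrite (_ : [set y | B (1 * y + x)%R] = [set y | B (x + y)%R]); last first.
      by apply/seteqP; split=> y /=; rewrite mul1r addrC.
    by apply: eq_integral => y _; rewrite mul1r addrK.
  rewrite integral_mkcond; apply: eq_integral => z _.
  by rewrite patchE indicE; case: ifP; rewrite ?mulr1 ?mulr0.
rewrite (@ge0_integral_density _ _ _ mu _ (normal_pdf 0 (Num.sqrt a)))//=; last 3 first.
- exact: measurable_normal_pdf.
- by move=> x; exact: normal_pdf_ge0.
- under eq_fun do rewrite shiftE.
  apply: (@measurable_fun_fubini_tonelli_F _ _ _ _ _ mu (EFin \o q)) => //.
  + exact/measurable_EFinP.
  + by move=> p; rewrite /= lee_fin mulr_ge0 ?normal_pdf_ge0.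
transitivity (\int[mu]_x \int[mu]_z (EFin \o h) (x, z)).
  apply: eq_integral => x _; rewrite shiftE muleC -ge0_integralZl//.
  - by apply: eq_integral => z _; rewrite -EFinM /h/=; congr EFin; rewrite mulrC.
  - apply/measurable_EFinP/measurable_funM => //.
    apply/(measurableT_comp (measurable_normal_pdf _ _)).
    exact: measurable_funB.
  - by move=> z _; rewrite lee_fin mulr_ge0 ?normal_pdf_ge0.
rewrite (@fubini_tonelli _ _ _ _ _ mu mu (EFin \o h))// /normal_prob [RHS]integral_mkcond.
apply: eq_integral => z _; rewrite patchE.
under eq_integral do rewrite /h/q/= mulrAC normal_pdf_conv// mulrAC EFinM.
rewrite ge0_integralZl//; last 2 first.
- exact: mpdf.
- by rewrite lee_fin mulr_ge0 ?normal_pdf_ge0.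
rewrite integral_normal_pdf mule1 indicE.
by case: ifP; rewrite ?mulr1 ?mulr0.
Qed.

End normal.

(** * Generated sigma-algebras and independence *)

Section preimage.
Variables (S T : Type) (f : S -> T).

(** The sets whose preimage lies in [H] form a sigma-algebra containing [G]. *)
Lemma preimage_g_sigma (G : set (set T)) (H : set (set S)) :
  sigma_algebra setT H -> (forall A, G A -> H (f @^-1` A)) ->
  forall A, <<s G >> A -> H (f @^-1` A).
Proof.
move=> [H0 HC HU] GH A sGA.
suff : <<s G >> `<=` [set A | H (f @^-1` A)] by apply.
apply: smallest_sub => //; split => /=.
- by rewrite preimage_set0.
- by move=> B HB; rewrite setTD preimage_setC -setTD; exact: HC.
- by move=> F HF; rewrite preimage_bigcup; exact: HU.
Qed.

End preimage.

Lemma g_sigma_setI T (G : set (set T)) A B : <<s G >> A -> <<s G >> B ->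
  <<s G >> (A `&` B).
Proof.
by have [_ _ _] := (sigma_algebraP (fun _ _ => @subsetT _ _)).1
  (@smallest_sigma_algebra _ setT G); exact.
Qed.

Lemma g_sigma_setC T (G : set (set T)) A : <<s G >> A -> <<s G >> (~` A).
Proof. by move=> GA; rewrite -setTD; exact: sigma_algebraCD. Qed.

Lemma g_sigma_setT T (G : set (set T)) : <<s G >> setT.
Proof. by have := g_sigma_setC (@sigma_algebra0 T setT G); rewrite setC0. Qed.

(** Once [T] carries the sigma-algebra generated by [G], this is the measurability of a finite sum
    of measurable functions. *)
Lemma g_sigma_preimage_sum (R : realType) (T : Type) (G : set (set T))
    (I : eqType) (s : seq I) (h : I -> T -> R) :
  (forall i B, i \in s -> measurable B -> <<s G >> (h i @^-1` B)) ->
  forall B, measurable B -> <<s G >> ((fun x => \sum_(i <- s) h i x) @^-1` B).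
Proof.
move=> hG B mB.
have [[x0 _]|T0] := pselect (exists x : T, True); last first.
  rewrite (_ : _ @^-1` _ = setT); first exact: g_sigma_setT.
  by apply/seteqP; split=> // x _; exfalso; apply: T0; exists x.
(* [measurable_sum] requires a measurable type, and those are pointed. *)
pose pT : pointedType :=
  HB.pack T (gen_eqMixin T) (gen_choiceMixin T) (isPointed.Build T x0).
(* Terms outside [s] are replaced by 0: [measurable_sum] asks for all terms to be measurable, while
   [hG] covers only [i \in s]. *)
have : measurable_fun setT (fun x : @g_sigma_algebraType pT G =>
    \sum_(i <- s) (if i \in s then h i x else 0)).
  apply: measurable_sum => i; case: (boolP (i \in s)) => [si|_] _ C mC.
    by rewrite setTI; exact: (hG i C si mC).
  exact: (@measurable_cst _ _ (@g_sigma_algebraType pT G) R setT 0).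
move=> /(_ measurableT B mB); rewrite setTI.
by under eq_fun do rewrite -big_mkcond -big_seq.
Qed.

Section independence.
Context d (Omega : measurableType d) (R : realType) (P : probability Omega R).

Lemma g_sigma_measurable (G : set (set Omega)) :
  G `<=` measurable -> <<s G >> `<=` measurable.
Proof. by apply: smallest_sub; exact: sigma_algebra_measurable. Qed.

Lemma measure_bigcupT (F : (set Omega)^nat) : (forall n, measurable (F n)) ->
  trivIset setT F -> P (\bigcup_n F n) = (\sum_(n <oo) P (F n))%E.
Proof.
move=> mF tF; rewrite measure_bigcup//.
by apply: eq_eseriesl => n; rewrite in_setT.
Qed.

(** Dynkin's theorem: the sets on which two laws agree form a lambda-system. Measurability of
    preimages is carried along because [T] is a bare type. *)
Lemma eq_law_g_sigma (T : Type) (f g : Omega -> T) (G : set (set T)) :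
  setI_closed G ->
  (forall A, G A -> [/\ measurable (f @^-1` A), measurable (g @^-1` A) &
    P (f @^-1` A) = P (g @^-1` A)]) ->
  forall A, <<s G >> A -> P (f @^-1` A) = P (g @^-1` A).
Proof.
move=> GI fg A sGA.
suff : <<s G >> `<=` [set A | [/\ measurable (f @^-1` A), measurable (g @^-1` A) &
    P (f @^-1` A) = P (g @^-1` A)]] by move=> /(_ A sGA)[].
apply: lambda_system_subset => //; apply/dynkin_lambda_system; split => /=.
- by rewrite !preimage_setT.
- move=> B [mf mg E]; split; first by rewrite preimage_setC; exact: measurableC.
    by rewrite preimage_setC; exact: measurableC.
  have pC (h : Omega -> T) : h @^-1` (~` B) = ~` (h @^-1` B) by rewrite preimage_setC.
  by rewrite (pC f) (pC g) (probability_setC P mf) (probability_setC P mg) E.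
- move=> F tF HF; rewrite /= (preimage_bigcup _ f) (preimage_bigcup _ g).
  have tr (h : Omega -> T) : trivIset setT (fun k => h @^-1` F k).
    apply/trivIsetP => i j _ _ ij; move/trivIsetP : tF => /(_ i j I I ij) Fij.
    by apply/seteqP; split => // w Fw; have : (F i `&` F j) (h w) := Fw; rewrite Fij.
  have mf n : measurable (f @^-1` F n) by have [] := HF n.
  have mg n : measurable (g @^-1` F n) by have [] := HF n.
  split; [exact: bigcupT_measurable|exact: bigcupT_measurable|].
  rewrite (measure_bigcupT mf (tr f)) (measure_bigcupT mg (tr g)).
  by apply: eq_eseriesr => n _; have [] := HF n.
Qed.

(** Dynkin's theorem again: for fixed [B], the events obeying the product rule form a
    lambda-system. *)
Lemma indep_g_sigma (G : set (set Omega)) (B : set Omega) :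
  G `<=` measurable -> setI_closed G -> measurable B ->
  (forall A, G A -> P (A `&` B) = (P A * P B)%E) ->
  forall A, <<s G >> A -> P (A `&` B) = (P A * P B)%E.
Proof.
move=> Gm GI mB GB A sGA.
have fP C : measurable C -> P C \is a fin_num by move=> mC; exact: fin_num_measure.
suff : <<s G >> `<=` [set A | measurable A /\ P (A `&` B) = (P A * P B)%E].
  by move=> /(_ A sGA)[].
apply: lambda_system_subset => //; last by move=> C GC; split; [exact: Gm|exact: GB].
apply/dynkin_lambda_system; split => /=.
- by rewrite setTI probability_setT mul1e.
- move=> C [mC E]; split; first exact: measurableC.
  have -> : P (~` C `&` B) = (P B - P (C `&` B))%E.
    rewrite setIC -setDE measureD ?ltey_eq ?fP//.
    by rewrite [B `&` C]setIC.
  rewrite E (probability_setC P mC) muleBl ?fP ?mul1e//.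
- move=> F tF HF; split; first by apply: bigcupT_measurable => n; have [] := HF n.
  have mF n : measurable (F n) by have [] := HF n.
  rewrite setI_bigcupl (measure_bigcupT mF tF) measure_bigcupT; last 2 first.
  + by move=> n; apply: measurableI; first exact: mF.
  + exact: trivIset_setIr.
  under eq_eseriesr do rewrite (HF _).2 -(fineK (fP B mB)) muleC.
  by rewrite nneseriesZl// muleC fineK// fP.
Qed.

(** One side is extended at a time: first [B] to [<<s H >>] for [A] in [G], then [A] to
    [<<s G >>]. *)
Lemma indep2_g_sigma (G H : set (set Omega)) :
  G `<=` measurable -> setI_closed G -> H `<=` measurable -> setI_closed H ->
  indep2 P G H -> indep2 P <<s G >> <<s H >>.
Proof.
move=> Gm GI Hm HI GH A B GA HB.
apply: (indep_g_sigma Gm GI) => //; first exact: g_sigma_measurable HB.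
move=> {GA}A GA; rewrite setIC muleC; apply: (indep_g_sigma Hm HI) => //.
  exact: Gm.
by move=> {HB}B HB; rewrite setIC muleC; exact: GH.
Qed.

(** The pi-system to which the product rule of [mutual_indep] applies directly; the list is
    duplicate-free because that rule requires it. *)
Definition cylinders (I : choiceType) (T : Type) (F : I -> set (set T)) (S : set I) :=
  [set A | exists J : seq I, exists A_ : I -> set T,
    [/\ uniq J, forall i, i \in J -> S i, forall i, i \in J -> F i (A_ i) &
        A = \bigcap_(i in [set i | i \in J]) A_ i] ].

(** An index common to both lists receives the intersection of its two events, whence the hypothesis
    on [F i]. *)
Lemma cylinders_setI (I : choiceType) (T : Type) (F : I -> set (set T)) (S : set I) :
  (forall i, setI_closed (F i)) -> setI_closed (cylinders F S).
Proof.
move=> FI _ _ [J [A [uJ JS FA ->]]] [K [B [uK KS FB ->]]].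
exists (undup (J ++ K)).
exists (fun i => if i \in J then (if i \in K then A i `&` B i else A i) else B i).
split; first exact: undup_uniq.
- by move=> i; rewrite mem_undup mem_cat => /orP[/JS|/KS].
- move=> i; rewrite mem_undup mem_cat.
  case: ifP => iJ; last by rewrite /= => /FB.
  by case: ifP => iK _; [apply: FI; [exact: FA|exact: FB]|exact: FA].
- apply/seteqP; split => [x [Ax Bx] i /=|x ABx].
    rewrite mem_undup mem_cat; case: ifP => iJ.
      by case: ifP => iK _; [split; [exact: Ax|exact: Bx]|exact: Ax].
    by move=> /Bx.
  split=> i /= iJK; have := ABx i; rewrite /= mem_undup mem_cat iJK ?orbT => /(_ erefl).
    by case: ifP => // _ [].
  by case: ifP => // _ [].
Qed.

Lemma cylinder1 (I : choiceType) (T : Type) (F : I -> set (set T)) (S : set I) i A :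
  S i -> F i A -> cylinders F S A.
Proof.
move=> Si FA; exists [:: i], (fun _ => A); split => //.
- by move=> j; rewrite inE => /eqP ->.
- by move=> j; rewrite inE => /eqP ->.
- apply/seteqP; split => [x Ax j //|x]; by apply => /=; rewrite inE.
Qed.

Lemma cylinders_measurable (I : choiceType) (F : I -> set (set Omega)) (S : set I) :
  (forall i, F i `<=` measurable) -> cylinders F S `<=` measurable.
Proof.
move=> Fm _ [J [A [_ _ FA ->]]].
apply: fin_bigcap_measurable; first exact: finite_seq.
by move=> i /= /FA; exact: Fm.
Qed.

(** Cylinders over [S] and over [T] meet in a cylinder over the concatenated lists, whose
    probability factors; Dynkin's theorem extends this to the generated sigma-algebras. *)
Lemma mutual_indep_disjoint (I : choiceType) (F : I -> set (set Omega)) (S T : set I) :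
  (forall i, F i `<=` measurable) -> (forall i, setI_closed (F i)) ->
  mutual_indep P F -> [disjoint S & T]%classic ->
  indep2 P <<s \bigcup_(i in S) F i >> <<s \bigcup_(i in T) F i >>.
Proof.
move=> Fm FI Find /disj_setPS ST.
suff CD : indep2 P <<s cylinders F S >> <<s cylinders F T >>.
  move=> A B sA sB; apply: CD.
    by move: sA; apply: sub_sigma_algebra2 => C [i Si FC]; exact: cylinder1 FC.
  by move: sB; apply: sub_sigma_algebra2 => C [i Si FC]; exact: cylinder1 FC.
apply: indep2_g_sigma; [exact: cylinders_measurable|exact: cylinders_setI|
  exact: cylinders_measurable|exact: cylinders_setI|].
move=> _ _ [J [A [uJ JS FA ->]]] [K [B [uK KT FB ->]]].
have JK i : i \in J -> i \in K -> False by move=> /JS Si /KT Ti; exact: (ST i).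
rewrite (Find J A)// (Find K B)//.
(* Both families are merged into one; no conflict arises since [J] and [K] are disjoint. *)
pose C i := if i \in J then A i else B i.
have uJK : uniq (J ++ K).
  rewrite cat_uniq uJ uK andbT/=; apply/hasPn => i iK.
  by apply/negP => iJ; exact: JK iJ iK.
have EA : (\prod_(i <- J) P (A i) = \prod_(i <- J) P (C i))%E.
  by apply: eq_big_seq => i iJ; rewrite /C iJ.
have EB : (\prod_(i <- K) P (B i) = \prod_(i <- K) P (C i))%E.
  apply: eq_big_seq => i iK; rewrite /C; case: ifP => // iJ.
  by have := JK _ iJ iK.
rewrite EA EB -big_cat/= -(Find (J ++ K) C)//.
  congr (P _); apply/seteqP; split => [x [Ax Bx] i /=|x Cx].
    rewrite mem_cat /C; case: ifP => [iJ _|_ iK]; first exact: Ax.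
    exact: Bx.
  split=> i /= iJ; have := Cx i; rewrite /= mem_cat iJ ?orbT /C => /(_ erefl)//.
    by rewrite iJ.
  by case: ifP => // iJ'; have := JK _ iJ' iJ.
move=> i; rewrite mem_cat /C; case: ifP => [iJ _|_ iK]; first exact: FA.
exact: FB.
Qed.

End independence.

(** * Approximation of events along an increasing family of sigma-algebras *)

Section approximation.
Context d (Omega : measurableType d) (R : realType) (P : probability Omega R).

(** The approximable sets form a lambda-system, and the union of the [F n] is a pi-system because
    the family increases. *)
Lemma g_sigma_approx (T : Type) (f : Omega -> T) (F : nat -> set (set T)) :
  (forall n, sigma_algebra setT (F n)) ->
  (forall m n, (m <= n)%N -> F m `<=` F n) ->
  (forall n A, F n A -> measurable (f @^-1` A)) ->
  forall B, <<s \bigcup_n F n >> B -> forall e : R, 0 < e ->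
  exists n A, F n A /\ (P (f @^-1` (A `+` B)) < e%:E)%E.
Proof.
move=> Fs Fnd Fm B sB.
pose H := [set B | measurable (f @^-1` B) /\ forall e : R, 0 < e ->
  exists n A, F n A /\ (P (f @^-1` (A `+` B)) < e%:E)%E].
suff /(_ B sB)[] : <<s \bigcup_n F n >> `<=` H by [].
have mY A C : measurable (f @^-1` A) -> measurable (f @^-1` C) ->
    measurable (f @^-1` (A `+` C)).
  move=> mA mC; exact: (measurableU _ _ (measurableD mA mC) (measurableD mC mA)).
have FP n := (sigma_algebraP (fun _ _ => @subsetT _ _)).1 (Fs n).
have FT n : F n setT by have [] := FP n.
have FI n : setI_closed (F n) by have [] := FP n.
have FD n A C : F n A -> F n C -> F n (A `\` C).
  move=> FA FC; rewrite setDE; apply: FI => //.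
  by rewrite -setTD; have [_ + _] := Fs n; apply.
apply: lambda_system_subset => //.
- move=> A C [n _ FA] [m _ FC]; exists (maxn n m) => //.
  by apply: FI; [exact: (Fnd _ _ (leq_maxl n m))|exact: (Fnd _ _ (leq_maxr n m))].
- split => //.
  + split; first by rewrite preimage_setT.
    move=> e e0; exists 0%N, setT; split => //.
    by rewrite setYK preimage_set0 measure0 lte_fin.
  + move=> A C CA [mA HA] [mC HC]; split.
      exact: (measurableD mA mC).
    move=> e e0; have e20 : 0 < e / 2 by rewrite divr_gt0.
    have [n [A' [FA' PA']]] := HA _ e20; have [m [C' [FC' PC']]] := HC _ e20.
    (* Both approximations are moved to a common level, where their difference can be formed. *)
    have {}FA' : F (maxn n m) A' by exact: (Fnd _ _ (leq_maxl n m)).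
    have {}FC' : F (maxn n m) C' by exact: (Fnd _ _ (leq_maxr n m)).
    exists (maxn n m), (A' `\` C'); split; first exact: FD.
    have mA' := Fm _ _ FA'; have mC' := Fm _ _ FC'.
    rewrite (splitr e) EFinD; apply: le_lt_trans (lteD PA' PC').
    apply: le_trans (measureU2 _ _ _); [|exact: mY..].
    rewrite -preimage_setU; apply: le_measure; rewrite ?inE.
    * exact: (mY _ _ (measurableD mA' mC') (measurableD mA mC)).
    * exact: (measurableU _ _ (mY _ _ mA' mA) (mY _ _ mC' mC)).
    * move=> w /=; rewrite /setY/=.
      by have := pselect (A' (f w)); have := pselect (C' (f w));
         have := pselect (A (f w)); have := pselect (C (f w)); tauto.
  + move=> A ndA HA; have mA n : measurable (f @^-1` A n) by have [] := HA n.
    have mU : measurable (f @^-1` \bigcup_n A n).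
      by rewrite preimage_bigcup; exact: bigcupT_measurable.
    split=> // e e0; have e20 : 0 < e / 2 by rewrite divr_gt0.
    (* [D n] decreases to the empty set, so by continuity from above some [A n] misses at most
       [e / 2] of the union; an approximation of that [A n] then serves. *)
    pose D n := f @^-1` (\bigcup_n A n) `\` f @^-1` A n.
    have mD n : measurable (D n) by exact: measurableD.
    have D0 : \bigcap_n D n = set0.
      apply/seteqP; split => // w Dw; have [[n _ An] _] := Dw 0%N I.
      by have [_ /(_ An)] := Dw n I.
    have : P (D n) @[n --> \oo] --> P (\bigcap_n D n).
      apply: nonincreasing_cvg_mu => //.
      - by rewrite ltey_eq fin_num_measure.
      - by rewrite D0.
      - move=> m n mn; apply/subsetPset => w [Uw nAw]; split=> // Amw; apply: nAw.
        by have /subsetPset := ndA _ _ mn; apply.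
    rewrite D0 measure0 => /fine_cvgP[_ /cvgrPdist_lt /(_ _ e20)[n _ /(_ n (leqnn n))]].
    rewrite sub0r normrN ger0_norm ?fine_ge0// => PD.
    have [_ /(_ _ e20)[m [C [FC PC]]]] := HA n.
    exists m, C; split => //; have mC := Fm _ _ FC.
    have {}PD : (P (D n) < (e / 2)%:E)%E.
      by rewrite -(@fineK _ (P (D n))) ?lte_fin// fin_num_measure.
    rewrite (splitr e) EFinD; apply: le_lt_trans (lteD PC PD).
    apply: le_trans (measureU2 _ _ _) => //; last exact: mY.
    apply: le_measure; rewrite ?inE.
    * exact: mY.
    * by apply: measurableU => //; exact: mY.
    * move=> w /=; rewrite /setY/= /D /setD/=.
      have nU : A n (f w) -> (\bigcup_n A n) (f w) by exists n.
      by have := pselect (C (f w)); have := pselect (A n (f w)); tauto.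
- move=> A [n _ FA]; split; first exact: Fm FA.
  by move=> e e0; exists n, A; split => //; rewrite setYK preimage_set0 measure0 lte_fin.
Qed.

End approximation.

(** * Sums of independent centered normal variables *)

Section gauss_law.
Context d (Omega : measurableType d) (R : realType) (P : probability Omega R).

(** Independence makes the joint law agree with the product measure on rectangles, hence everywhere;
    the integral is the product measure of the set where the sum lies in [B], computed by
    sections. *)
Lemma law_add (U V : Omega -> R) (mu nu : probability (measurableTypeR R) R) :
  measurable_fun setT U -> measurable_fun setT V ->
  (forall B, measurable B -> P (U @^-1` B) = mu B) ->
  (forall B, measurable B -> P (V @^-1` B) = nu B) ->
  (forall A B, measurable A -> measurable B ->
    P (U @^-1` A `&` V @^-1` B) = (P (U @^-1` A) * P (V @^-1` B))%E) ->
  forall B : set R, measurable B ->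
  P [set w | B (U w + V w)] = (\int[mu]_x nu [set y | B (x + y)%R])%E.
Proof.
move=> mU mV PU PV UV B mB.
pose UVf : Omega -> measurableTypeR R * measurableTypeR R := fun w => (U w, V w).
have mUV : measurable_fun setT UVf by exact: measurable_fun_pair.
pose C := [set p : measurableTypeR R * measurableTypeR R | B (p.1 + p.2)].
have mC : measurable C.
  have : measurable_fun setT
      (fun p : measurableTypeR R * measurableTypeR R => (p.1 + p.2)%R).
    by apply: measurable_funD; [exact: measurable_fst|exact: measurable_snd].
  by move=> /(_ measurableT B mB); rewrite setTI.
have /(_ _ C mC) := @product_measure_unique _ _ _ _ _ mu nu
  (measure_function_pushforward__canonical__measure_function_Measure P mUV).
move=> E; rewrite -[LHS]/(pushforward P UVf C) -E.
  rewrite /product_measure1; apply: eq_integral => x _.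
  by congr (nu _); apply/seteqP; split=> y; rewrite /xsection/= inE.
move=> A D mA mD; have := UV A D mA mD; rewrite (PU _ mA) (PV _ mD); exact.
Qed.

(** The centered [gauss_law] packaged as a probability, so that it can be integrated against. *)
Definition gauss_prob (v : R) : probability (measurableTypeR R) R :=
  if v == 0 then (@dirac _ (measurableTypeR R) 0 R : probability _ R)
  else (normal_prob 0 (Num.sqrt v) : probability _ R).

Lemma gauss_probE (v : R) (B : set R) : gauss_law 0 v B = gauss_prob v B.
Proof. by rewrite /gauss_law /gauss_prob; case: ifP. Qed.

(** Variance 0 is handled apart: the point mass at 0 is neutral for convolution. Otherwise this is
    [normal_prob_conv]. *)
Lemma gauss_prob_conv (a b : R) (B : set R) : 0 <= a -> 0 <= b -> measurable B ->
  (\int[gauss_prob a]_x gauss_prob b [set y | B (x + y)%R])%E = gauss_prob (a + b) B.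
Proof.
move=> a0 b0 mB; rewrite /gauss_prob.
have dirac_addE (x : R) :
    @dirac _ (measurableTypeR R) 0 R [set y | B (x + y)%R] = (\1_B x)%:E.
  rewrite diracE indicE; congr (_%:R%:E); congr nat_of_bool.
  by apply/idP/idP; rewrite !inE/= addr0.
have [->|an0] := eqVneq a 0.
  rewrite add0r integral_dirac//=.
    rewrite diracT mul1e (_ : [set y | B (0 + y)%R] = B)//.
    by apply/seteqP; split => y /=; rewrite add0r.
  (* What remains is the measurability in [x] that [integral_dirac] requires: the integrand is the
     measure of a section of [C]. *)
  pose C := [set p : measurableTypeR R * measurableTypeR R | B (p.1 + p.2)].
  have mC : measurable C.
    have : measurable_fun setT
        (fun p : measurableTypeR R * measurableTypeR R => (p.1 + p.2)%R).
      by apply: measurable_funD; [exact: measurable_fst|exact: measurable_snd].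
    by move=> /(_ measurableT B mB); rewrite setTI.
  have := measurable_fun_xsection (gauss_prob b) mC.
  apply: eq_measurable_fun => x _ /=; rewrite /gauss_prob.
  rewrite (_ : xsection C x = [set y | B (x + y)%R])//.
  by apply/seteqP; split=> y; rewrite /xsection/= inE.
have [->|bn0] := eqVneq b 0.
  rewrite addr0 (negbTE an0).
  transitivity (\int[normal_prob 0 (Num.sqrt a)]_x (\1_B x)%:E)%E.
    by apply: eq_integral => x _; exact: dirac_addE.
  by rewrite integral_indic// setIT.
rewrite paddr_eq0// (negbTE an0)/=.
by apply: normal_prob_conv => //; rewrite lt0r ?an0 ?bn0.
Qed.

Lemma gauss_law_add (U V : Omega -> R) (a b : R) :
  measurable_fun setT U -> measurable_fun setT V -> 0 <= a -> 0 <= b ->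
  (forall B, measurable B -> P (U @^-1` B) = gauss_law 0 a B) ->
  (forall B, measurable B -> P (V @^-1` B) = gauss_law 0 b B) ->
  (forall A B, measurable A -> measurable B ->
    P (U @^-1` A `&` V @^-1` B) = (P (U @^-1` A) * P (V @^-1` B))%E) ->
  forall B : set R, measurable B ->
  P [set w | B (U w + V w)] = gauss_law 0 (a + b) B.
Proof.
move=> mU mV a0 b0 PU PV UV B mB.
rewrite gauss_probE -gauss_prob_conv//; apply: law_add => // C mC.
  by rewrite PU// gauss_probE.
by rewrite PV// gauss_probE.
Qed.

Definition rv_sigma (Z : Omega -> R) : set (set Omega) :=
  [set A | exists2 B : set R, measurable B & A = Z @^-1` B].

Lemma rv_sigma_setI (Z : Omega -> R) : setI_closed (rv_sigma Z).
Proof.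
move=> _ _ [A mA ->] [B mB ->]; exists (A `&` B) => //; exact: measurableI.
Qed.

Lemma rv_sigma_measurable (Z : Omega -> R) : measurable_fun setT Z ->
  rv_sigma Z `<=` measurable.
Proof. by move=> mZ _ [A mA ->]; rewrite -[X in measurable X]setTI; exact: mZ. Qed.

(** Induction on [s]: the head is independent of the sum of the tail, which is measurable for the
    sigma-algebra of the other indices. The empty sum is the point mass at 0. *)
Lemma gauss_law_sum (I : choiceType) (s : seq I) (Z : I -> Omega -> R) (v : I -> R) :
  uniq s -> (forall i, measurable_fun setT (Z i)) -> (forall i, 0 <= v i) ->
  (forall i B, measurable B -> P (Z i @^-1` B) = gauss_law 0 (v i) B) ->
  mutual_indep P (fun i => rv_sigma (Z i)) ->
  forall B : set R, measurable B ->
  P [set w | B (\sum_(i <- s) Z i w)] = gauss_law 0 (\sum_(i <- s) v i) B.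
Proof.
move=> + mZ v0 PZ Zind; elim: s => [_|i s IHs /=/andP[si us]] B mB.
  rewrite /gauss_law !big_nil eqxx diracE.
  under eq_set do rewrite big_nil.
  have [B0|B0] := pselect (B 0).
    by rewrite mem_set//= (_ : [set _ | _] = setT) ?probability_setT//; apply/seteqP; split.
  by rewrite memNset//= (_ : [set _ | _] = set0) ?measure0//; apply/seteqP; split.
rewrite big_cons; under eq_set do rewrite big_cons.
apply: (gauss_law_add (mZ i) (measurable_sum s mZ) (v0 i)
  (sumr_ge0 _ (fun j _ => v0 j)) (PZ i) (IHs us)) => //.
move=> A C mA mC.
have disj : [disjoint [set i] & [set j | j \in s]]%classic.
  by apply/disj_setPS => j [/= ->]; rewrite (negbTE si).
apply: (mutual_indep_disjoint (fun i => @rv_sigma_measurable _ (mZ i))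
  (fun i => @rv_sigma_setI (Z i)) Zind disj).
  by apply: sub_sigma_algebra; exists i => //; exists A.
apply: g_sigma_preimage_sum => // j D sj mD.
by apply: sub_sigma_algebra; exists j => //; exists D.
Qed.

End gauss_law.

(** * The process *)

Section gen_sigma.
Context d (Omega : measurableType d) (R : realType).

Lemma sub_gen_sigma (I : Type) (Z : I -> Omega -> R) (S : set I) (i : I) (B : set R) :
  S i -> measurable B -> gen_sigma Z S (Z i @^-1` B).
Proof. by move=> Si mB; apply: sub_sigma_algebra; exists i, B. Qed.

Lemma gen_sigma_measurable (I : Type) (Z : I -> Omega -> R) (S : set I) :
  (forall i, measurable_fun setT (Z i)) -> gen_sigma Z S `<=` measurable.
Proof.
move=> mZ; apply: g_sigma_measurable => _ [i [B [_ mB ->]]].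
by rewrite -[X in measurable X]setTI; exact: mZ.
Qed.

Lemma gen_sigma_sub (I : Type) (Z : I -> Omega -> R) (S : set I) (G : set (set Omega)) :
  (forall i B, S i -> measurable B -> <<s G >> (Z i @^-1` B)) ->
  gen_sigma Z S `<=` <<s G >>.
Proof.
move=> ZG; apply: smallest_sub; first exact: smallest_sigma_algebra.
by move=> _ [i [B [Si mB ->]]]; exact: ZG.
Qed.

(** The generators of [coord_sigma] restricted to [S], which for ergodicity will be a finite window
    of times. *)
Definition coords (I : Type) (S : set I) : set (set (I -> R)) :=
  [set A | exists i (B : set R), [/\ S i, measurable B & A = (fun f => f i) @^-1` B]].

Lemma coord_sigmaE (I : Type) : @coord_sigma R I = <<s coords (@setT I) >>.
Proof.
congr (smallest _ _); apply/seteqP; split=> A.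
  by move=> [i [B [mB ->]]]; exists i, B.
by move=> [i [B [_ mB ->]]]; exists i, B.
Qed.

Lemma sub_coord_sigma (I : Type) (i : I) (B : set R) :
  measurable B -> coord_sigma ((fun f : I -> R => f i) @^-1` B).
Proof. by move=> mB; apply: sub_sigma_algebra; exists i, B. Qed.

Lemma gen_sigma_preimage (I J : Type) (Z : I -> Omega -> R) (S : set I) (T : set J)
    (h : J -> I) (C : set (J -> R)) :
  (forall j, T j -> S (h j)) -> <<s coords T >> C ->
  gen_sigma Z S ((fun w j => Z (h j) w) @^-1` C).
Proof.
move=> TS; apply: preimage_g_sigma; first exact: smallest_sigma_algebra.
by move=> _ [i [B [Ti mB ->]]]; exact: (sub_gen_sigma (Z := Z) (TS _ Ti) mB).
Qed.

End gen_sigma.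

Section process.
Context (R : realType) (n : nat).
(** With [k] a successor, ['I_n] indexes both the [k - 1] coordinates left after an omission,
    through [lift], and the [k - 1] chosen times. *)
Notation k := n.+1.
Variables (d : measure_display) (Omega : measurableType d) (P : probability Omega R).
Variables (X : int -> 'I_k -> Omega -> R) (nu : set ('I_k -> R) -> \bar R).
Hypothesis nu_marg : forall i j : 'I_k, j != i -> forall B : set R, measurable B ->
  nu [set x | B (x j)] = normal_prob 0 1 B.
Hypothesis nu_indep : forall i : 'I_k, forall B : 'I_k -> set R,
  (forall j, measurable (B j)) ->
  nu [set x | forall j, j != i -> B j (x j)]
  = (\prod_(j < k | j != i) nu [set x | B j (x j)])%E.
Hypothesis X_meas : forall m i, measurable_fun setT (X m i).
Hypothesis X_law : forall m B, coord_sigma B ->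
  P ((fun w i => X m i w) @^-1` B) = nu B.
Hypothesis X_indep : mutual_indep P (fun m => gen_sigma (X m) setT).

(* [rev_ord j] is the coordinate [k - j] in 1-based numbering. *)
Definition diag_sum (m : int) (w : Omega) : R :=
  \sum_(j < k) X (m + j%:Z) (rev_ord j) w.
Notation Y := diag_sum.

Lemma measurable_diag_sum m : measurable_fun setT (Y m).
Proof. exact: (measurable_sum _ (fun j => X_meas _ _)). Qed.

Lemma gen_sigma_diag_sum (S T : set int) :
  (forall m (j : 'I_k), S m -> T (m + j%:Z)) ->
  gen_sigma Y S `<=` <<s \bigcup_(m in T) gen_sigma (X m) setT >>.
Proof.
move=> ST; apply: gen_sigma_sub => m B Sm mB.
apply: (g_sigma_preimage_sum (h := fun j : 'I_k => X (m + j%:Z) (rev_ord j))) => // j C _ mC.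
apply: sub_sigma_algebra; exists (m + j%:Z); first exact: ST.
exact: sub_gen_sigma.
Qed.

Lemma diag_sum_indep (m : int) :
  indep2 P (gen_sigma Y [set i | i <= m]) (gen_sigma Y [set i | m + k%:Z <= i]).
Proof.
move=> A B YA YB.
(* The past up to [m] uses vectors of index at most [m + k - 1], which is [m + n]; the future starts
   at [m + k]. *)
have disj : [disjoint [set i : int | i <= m + n%:Z] & [set i : int | m + k%:Z <= i]]%classic.
  by apply/disj_setPS => i /= []; lia.
apply: (mutual_indep_disjoint _ _ X_indep disj).
- by move=> i; apply: gen_sigma_measurable; exact: X_meas.
- by move=> i C D; exact: g_sigma_setI.
- by apply: gen_sigma_diag_sum YA => i j /=; have := ltn_ord j; lia.
- by apply: gen_sigma_diag_sum YB => i j /=; lia.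
Qed.

(** * Strict stationarity *)

Let xcoord (m : int) : set (set (int -> 'I_k -> R)) :=
  [set A | exists2 C, coord_sigma C & A = (fun x => x m) @^-1` C].

Let xcoord_setI m : setI_closed (xcoord m).
Proof.
by move=> _ _ [A sA ->] [B sB ->]; exists (A `&` B) => //; exact: g_sigma_setI.
Qed.

Let Xpath (c : int) (w : Omega) : int -> 'I_k -> R := fun m i => X (m + c) i w.

Let gen_sigma_X m C : coord_sigma C ->
  gen_sigma (X m) setT ((fun w i => X m i w) @^-1` C).
Proof. by rewrite coord_sigmaE; exact: (gen_sigma_preimage (h := id)). Qed.

Let mX m C : coord_sigma C -> measurable ((fun w i => X m i w) @^-1` C).
Proof. by move=> sC; exact: (gen_sigma_measurable (X_meas m) (gen_sigma_X (m := m) sC)). Qed.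

(** The point is that [v] is chosen before [c]: it is a product of values of [nu], the same for
    every translate. *)
Let Xpath_cylinder A : cylinders xcoord setT A ->
  exists v, forall c, measurable (Xpath c @^-1` A) /\ P (Xpath c @^-1` A) = v.
Proof.
move=> [J [A_ [uJ _ xA ->]]].
have /choice[C HC] : forall m, exists C : set ('I_k -> R), coord_sigma C /\
    (m \in J -> A_ m = (fun x => x m) @^-1` C).
  move=> m; have [mJ|mJ] := boolP (m \in J).
    by have [C sC ->] := xA m mJ; exists C.
  by exists setT; split => //; exact: g_sigma_setT.
exists (\prod_(m <- J) nu (C m))%E => c.
(* Translation turns the condition on vector [m] into the same condition on vector [m + c]. *)
have -> : Xpath c @^-1` (\bigcap_(i in [set i | i \in J]) A_ i) =
    \bigcap_(i in [set i | i \in [seq m + c | m <- J]])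
      ((fun w s => X i s w) @^-1` C (i - c)).
  apply/seteqP; split=> w Aw i /=.
    move=> /mapP[m mJ ->]; rewrite addrK.
    by have := Aw m mJ; rewrite (HC m).2.
  move=> iJ; rewrite (HC i).2//=.
  have := Aw (i + c); rewrite /= addrK; apply.
  by apply/mapP; exists i.
split.
  apply: fin_bigcap_measurable; first exact: finite_seq.
  by move=> i _; apply: mX; exact: (HC _).1.
rewrite (X_indep (A := fun i => (fun w s => X i s w) @^-1` C (i - c))).
- by rewrite big_map; apply: eq_bigr => m _; rewrite addrK X_law//; exact: (HC _).1.
- by rewrite map_inj_uniq//; exact: addIr.
- by move=> i _; apply: gen_sigma_X; exact: (HC _).1.
Qed.

(** The translated path of [Y] is the image under a fixed measurable [Phi] of the translated path of
    [X], whose law does not depend on [c]. *)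
Lemma diag_sum_stationary (c : int) (B : set (int -> R)) : coord_sigma B ->
  P ((fun w m => Y (m + c) w) @^-1` B) = P ((fun w m => Y m w) @^-1` B).
Proof.
move=> sB.
pose Phi (x : int -> 'I_k -> R) (m : int) := \sum_(j < k) x (m + j%:Z) (rev_ord j).
have E e w : (fun m => Y (m + e) w) = Phi (Xpath e w).
  by apply/funext => m; apply: eq_bigr => j _; rewrite /Xpath addrAC.
have sPhi : <<s cylinders xcoord setT >> (Phi @^-1` B).
  move: sB; apply: preimage_g_sigma; first exact: smallest_sigma_algebra.
  move=> _ [m [C [mC ->]]].
  apply: (g_sigma_preimage_sum (h := fun (j : 'I_k) (x : int -> 'I_k -> R) =>
    x (m + j%:Z) (rev_ord j))) => // j D _ mD.
  apply: sub_sigma_algebra; apply: (@cylinder1 _ _ xcoord setT (m + j%:Z)) => //.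
  by exists ((fun f => f (rev_ord j)) @^-1` D) => //; exact: sub_coord_sigma.
have -> : (fun w m => Y (m + c) w) @^-1` B = Xpath c @^-1` (Phi @^-1` B).
  by apply/seteqP; split => w /=; rewrite E.
have -> : (fun w m => Y m w) @^-1` B = Xpath 0 @^-1` (Phi @^-1` B).
  have E0 w : (fun m => Y m w) = Phi (Xpath 0 w).
    by rewrite -E; apply/funext => m; rewrite addr0.
  by apply/seteqP; split => w /=; rewrite E0.
apply: (eq_law_g_sigma (cylinders_setI xcoord_setI) _ sPhi) => A /Xpath_cylinder[v Hv].
by have [mc Pc] := Hv c; have [m0 P0] := Hv 0; rewrite Pc P0.
Qed.

(** * Normality of linear combinations of [k - 1] values of the process *)

Lemma nu_coord_law (m : int) (s i : 'I_k) (B : set R) : s != i -> measurable B ->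
  P (X m s @^-1` B) = normal_prob 0 1 B.
Proof.
move=> si mB; rewrite -(nu_marg si mB) -(X_law m)//.
exact: (@sub_coord_sigma _ _ s).
Qed.

Lemma scaled_coord_law (m : int) (s i : 'I_k) (a : R) (B : set R) : s != i ->
  measurable B -> P ((fun w => a * X m s w) @^-1` B) = gauss_law 0 (a ^+ 2) B.
Proof.
move=> si mB; rewrite /gauss_law sqrf_eq0; case: eqVneq => [->|a0].
  rewrite diracE; have [B0|B0] := pselect (B 0).
    rewrite mem_set// (_ : _ @^-1` B = setT) ?probability_setT//.
    by apply/seteqP; split => // w _ /=; rewrite mul0r.
  rewrite memNset// (_ : _ @^-1` B = set0) ?measure0//.
  by apply/seteqP; split => // w /=; rewrite mul0r.
rewrite -normal_prob_scale// -(nu_coord_law m si)//.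
have : measurable_fun setT (fun x : R => a * x) by exact: measurable_funM.
by move=> /(_ measurableT B mB); rewrite setTI.
Qed.

Lemma prod_lift (s0 : 'I_k) (f : 'I_k -> \bar R) :
  (\prod_(s < k | s != s0) f s = \prod_(j < n) f (lift s0 j))%E.
Proof.
rewrite big_mkcond (bigD1_ord s0)//= eqxx mul1e.
by apply: eq_bigr => j _; rewrite eq_sym neq_lift.
Qed.

(** [nu_indep] speaks of all coordinates but [s0] at once; a sublist [J] is reached by imposing the
    trivial condition [setT] on the others. *)
Lemma mutual_indep_lift (m : int) (a : 'I_k -> R) (s0 : 'I_k) :
  mutual_indep P (fun j : 'I_n =>
    rv_sigma (fun w => a (lift s0 j) * X m (lift s0 j) w)).
Proof.
move=> J A uJ AJ; pose Z j w := a (lift s0 j) * X m (lift s0 j) w.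
(* [C j] absorbs the scaling factor: it is a condition on the bare coordinate. *)
have /choice[C HC] : forall j, exists C : set R, [/\ measurable C,
    j \in J -> A j = X m (lift s0 j) @^-1` C & j \notin J -> C = setT].
  move=> j; have [jJ|jJ] := boolP (j \in J); last by exists setT.
  have [B mB ->] := AJ j jJ; exists [set x | B (a (lift s0 j) * x)]; split => //.
  have : measurable_fun setT (fun x : R => a (lift s0 j) * x).
    exact: measurable_funM.
  by move=> /(_ measurableT B mB); rewrite setTI.
pose D s := if unlift s0 s is Some j then C j else setT.
have DE j : D (lift s0 j) = C j by rewrite /D liftK.
have mD s : measurable (D s).
  by rewrite /D; case: unlift => // j; have [] := HC j.
have sD s : coord_sigma [set x : 'I_k -> R | D s (x s)].
  exact: (@sub_coord_sigma _ _ s).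
have -> : \bigcap_(i in [set i | i \in J]) A i =
    (fun w s => X m s w) @^-1` [set x | forall s, s != s0 -> D s (x s)].
  apply/seteqP; split=> w Aw i /=.
    case: (unliftP s0 i) => [j ->|->]; last by rewrite eqxx.
    rewrite DE => _; have [_ CA nC] := HC j.
    have [jJ|jJ] := boolP (j \in J); last by rewrite (nC jJ).
    by have := Aw j jJ; rewrite (CA jJ).
  move=> iJ; have [_ CA _] := HC i; rewrite (CA iJ)/=.
  by have := Aw (lift s0 i); rewrite DE; apply; rewrite eq_sym neq_lift.
rewrite X_law; last first.
  (* [X_law] needs the event to be in [coord_sigma]; it is a finite intersection, built along a list
     of coordinates. *)
  have sr (r : seq 'I_k) : coord_sigma [set x | forall s, s \in r -> D s (x s)].
    elim: r => [|s r IHr].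
      rewrite (_ : [set x | _] = setT); first exact: g_sigma_setT.
      by apply/seteqP; split.
    rewrite (_ : [set x | _] = [set x | D s (x s)] `&`
      [set x | forall s, s \in r -> D s (x s)]);
        first by apply: g_sigma_setI; [exact: sD|exact: IHr].
    apply/seteqP; split=> x.
      move=> Dx; split=> [|i ir]; apply: Dx; first exact: mem_head.
      by rewrite inE ir orbT.
    by move=> [Dx Dr] i; rewrite inE => /orP[/eqP ->//|]; exact: Dr.
  rewrite (_ : [set x | _] =
    [set x | forall s, s \in [seq s <- enum 'I_k | s != s0] -> D s (x s)]).
    exact: sr.
  by apply/seteqP; split=> x Dx i; have := Dx i; rewrite mem_filter mem_enum andbT.
rewrite (nu_indep s0 mD) prod_lift (big_uniq _ uJ).
rewrite [RHS]big_mkcond.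
apply: eq_bigr => j _; rewrite -(X_law m)// DE.
have [_ CA nC] := HC j; case: ifPn => [jJ|/nC ->]; first by rewrite (CA jJ).
by rewrite preimage_setT probability_setT.
Qed.

(** The vanishing coefficient removes coordinate [s0], and the remaining ones are independent
    standard normal. *)
Lemma coord_combination_law (m : int) (a : 'I_k -> R) (s0 : 'I_k) (B : set R) :
  a s0 = 0 -> measurable B ->
  P [set w | B (\sum_s a s * X m s w)] = gauss_law 0 (\sum_s a s ^+ 2) B.
Proof.
move=> as0 mB; rewrite (bigD1_ord s0)//= as0 expr0n add0r.
under eq_set do rewrite (bigD1_ord s0)//= as0 mul0r add0r.
apply: (gauss_law_sum (Z := fun j w => a (lift s0 j) * X m (lift s0 j) w)
  (v := fun j => a (lift s0 j) ^+ 2)) => //.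
- exact: index_enum_uniq.
- by move=> j; apply: measurable_funM => //; exact: X_meas.
- by move=> j; exact: sqr_ge0.
- move=> j C mC; have sj : lift s0 j != s0 by rewrite eq_sym neq_lift.
  exact: (scaled_coord_law _ _ sj mC).
- exact: mutual_indep_lift.
Qed.

Lemma sum_seq_delta (T : eqType) (r : seq T) (e : T) (f : T -> R) : uniq r ->
  e \in r -> \sum_(m <- r) (if e == m then f m else 0) = f e.
Proof.
move=> ur er; rewrite (bigD1_seq e)//= eqxx big1 ?addr0// => m me.
by rewrite eq_sym (negbTE me).
Qed.

(** By injectivity at most one term is nonzero, so there are no cross terms. *)
Lemma sum_sqr_delta (e : 'I_n -> int) (t : 'I_n -> R) (m : int) : injective e ->
  (\sum_j (if e j == m then t j else 0)) ^+ 2 =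
  \sum_j (if e j == m then t j ^+ 2 else 0).
Proof.
move=> ei; have [[j jm]|nm] := pselect (exists j, e j = m).
  have nj i : i != j -> (e i == m) = false.
    by move=> ij; apply: contraNF ij => /eqP; rewrite -jm => /ei ->.
  rewrite (bigD1 j)//= [RHS](bigD1 j)//= jm eqxx !big1 ?addr0// => i ij;
    by rewrite nj.
by rewrite !big1 ?expr0n// => i _; case: eqP => // im; exfalso; apply: nm; exists i.
Qed.

Lemma diag_sum_gauss (ns : 'I_n -> int) (t : 'I_n -> R) (B : set R) :
  injective ns -> measurable B ->
  P [set w | B (\sum_(j < n) t j * Y (ns j) w)]
  = gauss_law 0 (k%:R * \sum_(j < n) t j ^+ 2) B.
Proof.
move=> ns_inj mB.
(* [e s j] is the index of the vector whose coordinate [s] occurs in [Y (ns j)]; hence [a m s] is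
   the total coefficient of [X m s], and [M] lists the vectors that occur. *)
pose e (s : 'I_k) (j : 'I_n) : int := ns j + (rev_ord s : nat)%:Z.
pose a (m : int) (s : 'I_k) : R := \sum_j (if e s j == m then t j else 0).
pose M := undup [seq e p.1 p.2 | p <- enum {: 'I_k * 'I_n}].
have uM : uniq M by exact: undup_uniq.
have eM s j : e s j \in M.
  by rewrite mem_undup; apply/mapP; exists (s, j); rewrite ?mem_enum.
have e_inj s : injective (e s) by move=> i j /addIr /ns_inj.
(* For each coordinate [s], every [t j] enters [a m s] for exactly one [m], so its square is counted
   [k] times in all. *)
have -> : k%:R * \sum_(j < n) t j ^+ 2 = \sum_(m <- M) \sum_s a m s ^+ 2.
  rewrite exchange_big/= -[k in LHS]card_ord mulr_natl -sumr_const.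
  apply: eq_bigr => s _.
  rewrite (eq_bigr (fun m => \sum_j (if e s j == m then t j ^+ 2 else 0))).
    by rewrite exchange_big/=; apply: eq_bigr => j _; rewrite sum_seq_delta.
  by move=> m _; exact: sum_sqr_delta.
have YE w : \sum_(j < n) t j * Y (ns j) w = \sum_(m <- M) \sum_s a m s * X m s w.
  rewrite [RHS]exchange_big/=.
  under [RHS]eq_bigr => s _.
    under eq_bigr do rewrite /a mulr_suml.
    rewrite exchange_big/=.
    under eq_bigr => j _.
      rewrite (eq_bigr (fun m => if e s j == m then t j * X m s w else 0)).
        rewrite sum_seq_delta//; over.
      by move=> m _; case: ifP => _; rewrite ?mul0r.
    over.
  rewrite /= exchange_big/=; apply: eq_bigr => j _.
  rewrite /diag_sum mulr_sumr (reindex_inj rev_ord_inj)/=.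
  by apply: eq_bigr => s _; rewrite rev_ordK.
under eq_set do rewrite YE.
(* Pigeonhole: otherwise each of the [k] coordinates [s] has some [j] with [e s j = m]; since [j]
   and [m] determine [s], this would inject ['I_k] into ['I_n]. *)
have a0 m : exists s0, a m s0 = 0.
  apply: contrapT => /forallNP na.
  have /choice[h hE] : forall s, exists j, e s j = m.
    move=> s; apply: contrapT => /forallNP ne; apply: (na s).
    by rewrite /a big1// => j _; case: eqP => // /ne.
  suff /leq_card : injective h by rewrite !card_ord ltnn.
  move=> s s' hs; have := hE s; rewrite -(hE s') /e hs => /addrI /eqP.
  by rewrite eqz_nat => /eqP /val_inj /rev_ord_inj.
apply: (gauss_law_sum (Z := fun m w => \sum_s a m s * X m s w)
  (v := fun m => \sum_s a m s ^+ 2)) => //.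
- move=> m; apply: measurable_sum => s; apply: measurable_funM => //; exact: X_meas.
- by move=> m; apply: sumr_ge0 => s _; exact: sqr_ge0.
- move=> m C mC; have [s0 as0] := a0 m.
  exact: (@coord_combination_law m (a m) s0 C as0 mC).
(* Each block is a function of the single vector [X m], so independence over [m] is inherited. *)
- move=> J A uJ AJ; apply: X_indep => // m /AJ[C mC ->].
  apply: g_sigma_preimage_sum => // s D _ mD.
  apply: (@sub_gen_sigma _ _ _ _ (X m) setT s [set x | D (a m s * x)]) => //.
  have : measurable_fun setT (fun x : R => a m s * x) by exact: measurable_funM.
  by move=> /(_ measurableT D mD); rewrite setTI.
Qed.

(** * Ergodicity *)

Let Ypath (w : Omega) : int -> R := fun m => Y m w.

Let mYpath B : coord_sigma B -> measurable (Ypath @^-1` B).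
Proof.
rewrite coord_sigmaE => sB.
apply: (gen_sigma_measurable measurable_diag_sum (S := setT)).
exact: (gen_sigma_preimage (h := id) _ sB).
Qed.

Lemma diag_sum_ergodic (B : set (int -> R)) : coord_sigma B ->
  @lshift_path R @^-1` B = B ->
  P (Ypath @^-1` B) = 0%:E \/ P (Ypath @^-1` B) = 1%:E.
Proof.
move=> sB shB.
have shiftB (c : nat) (y : int -> R) : B (fun m => y (m + c%:Z)) = B y.
  elim: c => [|c IH]; first by congr B; apply/funext => m; rewrite addr0.
  rewrite -IH -[in RHS]shB; congr B; apply/funext => m.
  by rewrite /lshift_path; congr y; lia.
pose F (N : nat) := <<s @coords R int [set i : int | - N%:Z <= i <= N%:Z] >>.
have FsubC N : F N `<=` @coord_sigma R int.
  by rewrite coord_sigmaE; apply: sub_sigma_algebra2 => _ [i [C [_ mC ->]]]; exists i, C.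
have mfin A : coord_sigma A -> P (Ypath @^-1` A) \is a fin_num.
  by move=> sA; rewrite fin_num_measure//; exact: mYpath.
have approx := @g_sigma_approx _ _ _ P _ Ypath F.
have {}approx (e : R) : 0 < e ->
    exists N A, F N A /\ (P (Ypath @^-1` (A `+` B)) < e%:E)%E.
  apply: approx.
  - by move=> N; exact: smallest_sigma_algebra.
  - move=> N N' NN'; apply: sub_sigma_algebra2 => _ [i [C [iN mC ->]]].
    by exists i, C; split => //=; move: iN => /=; lia.
  - by move=> N A /FsubC; exact: mYpath.
  - move: sB; rewrite coord_sigmaE; apply: sub_sigma_algebra2 => _ [i [C [_ mC ->]]].
    exists `|i|%N => //; apply: sub_sigma_algebra; exists i, C; split => //=; lia.
pose b := fine (P (Ypath @^-1` B)).
have bE : P (Ypath @^-1` B) = b%:E by rewrite fineK// mfin.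
suff : b ^+ 2 = b.
  rewrite bE => /eqP; rewrite expr2 -subr_eq0 -[X in _ - X]mulr1 -mulrBr mulf_eq0.
  by rewrite subr_eq0 => /orP[/eqP ->|/eqP ->]; [left|right].
have b01 : 0 <= b <= 1.
  rewrite -!lee_fin -bE measure_ge0 probability_le1//; exact: mYpath.
(* With [p] the probability of the approximating event, [p] is within [e] of [b], so [p ^+ 2] is
   within [2 * e] of [b ^+ 2]; it is also within [2 * e] of [b]. *)
suff key (e : R) : 0 < e -> `|b ^+ 2 - b| <= 4 * e.
  apply/eqP; rewrite -subr_eq0 -normr_le0; apply/ler_addgt0Pl => e e0.
  have e4 : 0 < e / 4 by rewrite divr_gt0.
  by apply: le_trans (key _ e4) _; lra.
move=> e0; have [N [A [FA PA]]] := approx e e0.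
have sA := FsubC _ _ FA.
(* This shift moves the window from [- N] to [N] onto times from [N + k] on, as [diag_sum_indep]
   with [m = N] requires. *)
pose c : int := (2 * N + k)%:Z.
pose S (y : int -> R) : int -> R := fun m => y (m + c).
pose A1 := Ypath @^-1` A; pose A2 := Ypath @^-1` (S @^-1` A).
pose B1 := Ypath @^-1` B.
have SB : S @^-1` B = B by apply/seteqP; split=> y /=; rewrite /S shiftB.
have sS C : coord_sigma C -> coord_sigma (S @^-1` C).
  apply: preimage_g_sigma; first exact: smallest_sigma_algebra.
  by move=> _ [i [D [mD ->]]]; exact: (@sub_coord_sigma _ _ (i + c)).
have mA1 : measurable A1 by exact: mYpath.
have mA2 : measurable A2 by apply: mYpath; exact: sS.
have mB1 : measurable B1 by exact: mYpath.
have stat C : coord_sigma C -> P (Ypath @^-1` (S @^-1` C)) = P (Ypath @^-1` C).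
  exact: diag_sum_stationary.
have indA : P (A1 `&` A2) = (P A1 * P A1)%E.
  rewrite -[in X in (_ * X)%E](stat A sA); apply: (diag_sum_indep (m := N%:Z)).
    by apply: (gen_sigma_preimage (h := id) _ FA) => i /= /andP[].
  by apply: (gen_sigma_preimage (h := fun i => i + c) _ FA) => i /=; lia.
have sAB : coord_sigma (A `+` B).
  rewrite /setY; have sD C D : coord_sigma C -> coord_sigma D -> coord_sigma (C `\` D).
    by move=> sC sD'; rewrite setDE; apply: g_sigma_setI => //; exact: g_sigma_setC.
  rewrite -(setCK (_ `|` _)) setCU; apply: g_sigma_setC; apply: g_sigma_setI;
    by apply: g_sigma_setC; exact: sD.
have PA1 : (P (A1 `+` B1) < e%:E)%E by [].
(* As [B] is invariant, this difference is the translate of the one for [A], and stationarity gives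
   it the same probability. *)
have PA2 : (P (A2 `+` B1) < e%:E)%E.
  rewrite (_ : A2 `+` B1 = Ypath @^-1` (S @^-1` (A `+` B))) ?stat//.
  by rewrite /B1 -[in LHS]SB.
have mY (C D : set Omega) : measurable C -> measurable D -> measurable (C `+` D).
  by move=> mC mD; exact: (measurableU _ _ (measurableD mC mD) (measurableD mD mC)).
have close (C D : set Omega) : measurable C -> measurable D ->
    (P C <= P D + P (C `+` D))%E.
  move=> mC mD; apply: le_trans (measureU2 _ _ _) => //; last exact: mY.
  apply: le_measure; rewrite ?inE//; first by apply: measurableU => //; exact: mY.
  by move=> w Cw; rewrite /setY/=; have [Dw|nDw] := pselect (D w); [left|right; left].
have fin C : measurable C -> P C = (fine (P C))%:E.
  by move=> mC; rewrite fineK// fin_num_measure.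
set p := fine (P A1).
have pE : P A1 = p%:E by exact: fin.
have p01 : 0 <= p <= 1 by rewrite -!lee_fin -pE measure_ge0 probability_le1.
have le_pb : p <= b + e.
  rewrite -lee_fin EFinD -bE -pE; apply: le_trans (close _ _ mA1 mB1) _.
  by apply: leeD => //; exact: ltW.
have le_bp : b <= p + e.
  rewrite -lee_fin EFinD -bE -pE; apply: le_trans (close _ _ mB1 mA1) _.
  by apply: leeD => //; rewrite setYC; exact: ltW.
have mI : measurable (A1 `&` A2) by exact: measurableI.
(* A point where [A1] and [A2] both agree with [B1] is one where their intersection does. *)
have PI : (P ((A1 `&` A2) `+` B1) <= (e + e)%:E)%E.
  rewrite EFinD; apply: le_trans (leeD (ltW PA1) (ltW PA2)).
  apply: le_trans (measureU2 _ _ _); [|exact: mY..].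
  apply: le_measure; rewrite ?inE//; [exact: mY|by apply: measurableU; exact: mY|].
  move=> w /=; rewrite /setY/=.
  by have := pselect (A1 w); have := pselect (A2 w); have := pselect (B1 w); tauto.
have le_p2b : p ^+ 2 <= b + (e + e).
  rewrite -lee_fin EFinD expr2 EFinM -pE -indA -bE.
  by apply: le_trans (close _ _ mI mB1) _; exact: leeD.
have le_bp2 : b <= p ^+ 2 + (e + e).
  rewrite -lee_fin EFinD expr2 EFinM -pE -indA -bE.
  by apply: le_trans (close _ _ mB1 mI) _; rewrite setYC; exact: leeD.
by rewrite ler_norml; apply/andP; split; nra.
Qed.

End process.

Theorem theorem2p1 (R : realType) (k : nat) (hk : (1 < k)%N)
  (nu : set ('I_k -> R) -> \bar R)
  (d : measure_display) (Omega : measurableType d) (P : probability Omega R)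
  (X : int -> 'I_k -> Omega -> R)
  (* nu is not gaussian *)
  (nu_not_gauss : ~ gaussian_law nu)
  (* omitting any coordinate i, the remaining k-1 coordinates are i.i.d. N(0,1) *)
  (nu_marg : forall i j : 'I_k, j != i -> forall B : set R, measurable B ->
      nu [set x | B (x j)] = normal_prob 0 1 B)
  (nu_indep : forall i : 'I_k, forall B : 'I_k -> set R,
      (forall j, measurable (B j)) ->
      nu [set x | forall j, j != i -> B j (x j)]
      = (\prod_(j < k | j != i) nu [set x | B j (x j)])%E)
  (* the X n are random vectors in R^k *)
  (X_meas : forall n i, measurable_fun setT (X n i))
  (* each X n has law nu *)
  (X_law : forall n B, coord_sigma B ->
      P ((fun w i => X n i w) @^-1` B) = nu B)
  (* the X n are mutually independent *)
  (X_indep : mutual_indep P (fun n => gen_sigma (X n) setT)) :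
  let Y : int -> Omega -> R :=
    fun n w => \sum_(j < k) X (n + j%:Z) (rev_ord j) w in
  let Ypath : Omega -> int -> R := fun w n => Y n w in
  (* strict stationarity *)
  (forall B, coord_sigma B -> P (Ypath @^-1` B) = P ((@lshift_path R \o Ypath) @^-1` B))
  /\
  (* (k-1)-step independence *)
  (forall m : int, indep2 P (gen_sigma Y [set n | n <= m])
                            (gen_sigma Y [set n | m + k%:Z <= n]))
  /\
  (* any k-1 distinct Y's form a gaussian vector with mean 0, covariance k I *)
  (forall ns : 'I_k.-1 -> int, (forall i j : 'I_k.-1, (i < j)%N -> ns i < ns j) ->
     forall t : 'I_k.-1 -> R, forall B : set R, measurable B ->
       P [set w | B (\sum_(j < k.-1) t j * Y (ns j) w)]
       = gauss_law 0 (k%:R * \sum_(j < k.-1) t j ^+ 2) B)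
  /\
  (* ergodicity with respect to the shift *)
  (forall B, coord_sigma B -> @lshift_path R @^-1` B = B ->
     P (Ypath @^-1` B) = 0%:E \/ P (Ypath @^-1` B) = 1%:E).
Proof.
case: k hk nu X nu_not_gauss nu_marg nu_indep X_meas X_law X_indep => [//|n] hk
  nu X _ nu_marg nu_indep X_meas X_law X_indep Y Ypath.
split; first by move=> B sB; exact/esym/(diag_sum_stationary X_meas X_law X_indep 1 sB).
split; first by move=> m; exact: (diag_sum_indep X_meas X_indep).
split.
  move=> ns ns_incr t B mB.
  apply: (diag_sum_gauss nu_marg nu_indep X_meas X_law X_indep) => // i j nsij.
  apply/val_inj; case: (ltngtP i j) => // [/ns_incr|/ns_incr]; by rewrite nsij ltxx.
by move=> B; exact: (diag_sum_ergodic X_meas X_law X_indep).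
Qed.
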